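(* Let $n\ge1$, $h:[n]\to[n]$ a Hessenberg function, $k=\mathrm{ht}(I_h)+1$, $\lambda\vdash n$ a partition with $k$ parts, and $T=\{\ell_1<\cdots<\ell_k\}\in\mathrm{SK}_k(\Gamma_h)$. Then for every integer $i$, the map $\Psi_T$ restricts to a bijection from $\mathcal{W}_i(\mathbb{J}_\lambda,h,T)$ onto $\mathcal{W}_{i-\deg_h(T)}(\mathbb{J}_{\lambda[1]},h[T])$.
   Context: A Hessenberg function on $[m]$ is a nondecreasing $h:[m]\to[m]$ with $h(j)\ge j$. For $\mathfrak{gl}(m,\mathbb{C})$: roots $t_a-t_b$ ($a\neq b$) identified with pairs $(a,b)$; $\Phi^\pm$ positive/negative roots ($a<b$ resp. $a>b$); simple roots $\Delta_m=\{\alpha_j=t_j-t_{j+1}:1\le j\le m-1\}$; $w(t_a-t_b)=t_{w(a)}-t_{w(b)}$; $\Phi_h^-=\{t_a-t_b:b<a\le h(b)\}$, $\Phi_h=\Phi_h^-\sqcup\Phi^+$, $I_h=\Phi^-\setminus\Phi_h^-$; $\mathrm{inv}(w)=\{(a,b):a>b,w(a)<w(b)\}$, $\mathrm{inv}_h(w)=\mathrm{inv}(w)\cap\Phi_h^-$; for $J\subseteq\Delta_m$, $\mathcal{W}_i(J,h)=\{w\in\mathfrak{S}_m:w^{-1}(J)\subseteq\Phi_h,\ w^{-1}(\Delta_m\setminus J)\subseteq I_h,\ |\mathrm{inv}_h(w)|=i\}$ (empty for $i<0$). For $\mu=(\mu_1,\dots,\mu_p)\vdash m$ with $p$ parts,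 $J_\mu=\Delta_m\setminus\{\alpha_{\mu_1},\dots,\alpha_{\mu_1+\cdots+\mu_{p-1}}\}$ and $\mathbb{J}_\lambda=\Delta_m\setminus J_{\lambda^\vee}$ with $\lambda^\vee$ the dual partition. $\lambda[1]$ is $\lambda$ with its first column removed, i.e. $(\lambda_1-1,\dots,\lambda_k-1)$. Height: for an ideal $I\subseteq\Phi^-$ (i.e. $\alpha\in I,\beta\in\Phi^-,\alpha+\beta\in\Phi^-\Rightarrow\alpha+\beta\in I$), set $I_1=I$, $I_j=\{\gamma+\beta:\gamma,\beta\in I_{j-1},\gamma+\beta\in\Phi^-\}$; $\mathrm{ht}(I)$ is the number of nonempty terms of this sequence. $I_h$ is an ideal. $\Gamma_h$: vertex set $[n]$, edges $\{a,b\}$ with $a<b\le h(a)$. $\mathrm{SK}_k(\Gamma_h)$: independent vertex sets of size $k$ (= sink sets of size $k$ of acyclic orientations). For an acyclic orientation $\omega$, $\mathrm{sk}(\omega)$ is its set of sinks and $\mathrm{asc}(\omega)$ the number of edges $\{a<b\}$ oriented from $a$ to $b$; $\deg_h(T)=\min\{\mathrm{asc}(\omega):\omega\text{ acyclic orientation of }\Gamma_h,\ \mathrm{sk}(\omega)=T\}$. $f_T:[n]\setminus T\to[n-k]$, $f_T(j)=j-|\{t\in T:t\le j\}|$ (increasing bijection). $h[T]:[n-k]\to[n-k]$ is the Hessenberg function $h[T](a)=|\{j\in[n]\setminus T: j\le h(f_T^{-1}(a))\}|$; its incomparability graph is $\Gamma_h$ with the vertices of $T$ (and incident edges) deleted,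 relabeled via $f_T$. $w_T\in\mathfrak{S}_n$: $w_T(\ell_j)=k-j+1$ for $1\le j\le k$, and the remaining positions $[n]\setminus T$, read left to right, carry $k+1,k+2,\dots,n$ in increasing order. $\mathcal{W}_i(\mathbb{J}_\lambda,h,T)=\{w\in\mathcal{W}_i(\mathbb{J}_\lambda,h):w(\ell_j)=k-j+1,\ 1\le j\le k\}$. Every $w\in\mathfrak{S}_n$ with $w(\ell_j)=k-j+1$ for all $j$ is uniquely $w=w_T\sigma$ with $\sigma\in\mathrm{Stab}(\ell_1,\dots,\ell_k)$ (permutations fixing each $\ell_j$); for such $\sigma$, $x_\sigma\in\mathfrak{S}_{n-k}$ is defined by $x_\sigma(f_T(j))=f_T(\sigma(j))$ for $j\notin T$, and $\Psi_T(w_T\sigma)=x_\sigma$.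
   Formalization: The height ht(I) is taken with the lower central series I_j = {γ+β : γ∈I_{j-1}, β∈I, γ+β∈Φ^-} instead of the printed γ,β∈I_{j-1}, for which the claim fails (n=5, h=(2,3,3,4,5), T={3,4,5}, λ=(3,1,1), i=2). *)

(* Defs.v *)
From mathcomp Require Import all_boot all_order all_algebra all_fingroup.
From mathcomp Require Import zify.

Set Implicit Arguments.
Unset Strict Implicit.
Unset Printing Implicit Defensive.

Import GRing.Theory Num.Theory.

(* Conventions: [m] is 'I_m, so positions and values are shifted by one with  *)
(* respect to the 1-based notation.  The root t_a - t_b is the pair (a, b).   *)

Section Roots.

Variable m : nat.
Implicit Types (h : 'I_m -> 'I_m) (w : 'S_m) (I J : {set 'I_m * 'I_m}).

Definition hessenberg h : Prop :=
  (forall i j : 'I_m, i <= j -> h i <= h j) /\ (forall j : 'I_m, j <= h j).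

Definition Phi_pos : {set 'I_m * 'I_m} := [set r : 'I_m * 'I_m | r.1 < r.2].
Definition Phi_neg : {set 'I_m * 'I_m} := [set r : 'I_m * 'I_m | r.2 < r.1].

(* The simple root t_j - t_(j+1) (1-based j) is the pair whose second         *)
(* component is the ordinal j.                                                *)
Definition simple_roots : {set 'I_m * 'I_m} :=
  [set r : 'I_m * 'I_m | r.2 == r.1.+1 :> nat].

Definition Phi_h_neg h : {set 'I_m * 'I_m} :=
  [set r : 'I_m * 'I_m | r.2 < r.1 <= h r.2].
Definition Phi_h h : {set 'I_m * 'I_m} := Phi_h_neg h :|: Phi_pos.
Definition I_h h : {set 'I_m * 'I_m} := Phi_neg :\: Phi_h_neg h.

(* The root as a linear form, in the basis of the coordinate forms t_a.       *)
Definition root_vec (r : 'I_m * 'I_m) : 'rV[int]_m :=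
  (delta_mx 0 r.1 - delta_mx 0 r.2)%R.

(* lower_central I j is the (j+1)-st term of the lower central series of the  *)
(* ideal I.  A term is built by adding elements of I to the previous term;    *)
(* adding two elements of the previous term would give the derived series,    *)
(* for which the height plus one is not the independence number of Gamma_h    *)
(* (already for m = 4 and h = id).                                            *)
Fixpoint lower_central I (j : nat) : {set 'I_m * 'I_m} :=
  if j is j'.+1 then
    [set r in Phi_neg | [exists c in lower_central I j', [exists b in I,
        root_vec r == (root_vec c + root_vec b)%R]]]
  else I.

(* The number of nonempty terms; those of index m or more are empty, see      *)
(* lower_central_eq0.                                                         *)
Definition height I : nat := #|[set j : 'I_m | lower_central I j != set0]|.

Lemma root_vec_height (r : 'I_m * 'I_m) :
  (\sum_(i < m) root_vec r 0%R i * i%:Z = r.1%:Z - r.2%:Z)%R.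
Proof.
have dsum (a : 'I_m) : (\sum_(i < m) (delta_mx 0 a : 'rV[int]_m) 0 i * i%:Z
    = a%:Z)%R.
  rewrite (bigD1 a) //= mxE !eqxx mul1r big1 ?addr0 // => i /negbTE nia.
  by rewrite mxE eqxx nia mul0r.
rewrite -[in RHS](dsum r.1) -[in RHS](dsum r.2) -sumrB.
by apply: eq_bigr => i _; rewrite !mxE mulrBl.
Qed.

Lemma lower_central_height I j r : I \subset Phi_neg ->
  r \in lower_central I j -> r.2 + j < r.1.
Proof.
move=> /subsetP sI; elim: j r => [|j IHj] r /=.
  by move/sI; rewrite inE addn0.
rewrite inE => /andP[_ /exists_inP[c cIj /exists_inP[b bI /eqP eq_r]]].
have /= := congr1 (fun v : 'rV_m => \sum_(i < m) v 0 i * i%:Z)%R eq_r.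
under [X in _ = X]eq_bigr do rewrite mxE mulrDl.
rewrite big_split /= !root_vec_height => eqZ.
have := IHj _ cIj; have := sI _ bI; rewrite inE.
move: (r.1 : nat) (r.2 : nat) (c.1 : nat) (c.2 : nat) eqZ => r1 r2 c1 c2.
by move: (b.1 : nat) (b.2 : nat) => b1 b2; lia.
Qed.

Lemma lower_central_eq0 I j :
  I \subset Phi_neg -> m <= j -> lower_central I j = set0.
Proof.
move=> sI le_m_j; apply/setP=> r; rewrite inE; apply/negP=> rIj.
have := lower_central_height sI rIj; rewrite ltnNge => /negP; apply.
by apply: leq_trans (leq_trans le_m_j (leq_addl _ _)); apply: ltnW.
Qed.

Definition root_act w (J : {set 'I_m * 'I_m}) : {set 'I_m * 'I_m} :=
  [set (w r.1, w r.2) | r in J].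

Definition inv_set w : {set 'I_m * 'I_m} :=
  [set r : 'I_m * 'I_m | (r.2 < r.1) && (w r.1 < w r.2)].
Definition inv_h h w : {set 'I_m * 'I_m} := inv_set w :&: Phi_h_neg h.

Definition W_set (i : int) J h : {set 'S_m} :=
  [set w : 'S_m |
     [&& root_act w^-1%g J \subset Phi_h h,
         root_act w^-1%g (simple_roots :\: J) \subset I_h h
       & #|inv_h h w|%:Z%R == i]].

End Roots.

Section Partitions.

Implicit Type la : seq nat.

(* A partition is the nonincreasing sequence of its (positive) parts. *)
Definition is_partition (n : nat) la : bool :=
  [&& sorted geq la, all (leq 1) la & sumn la == n].

Definition dual_partition la : seq nat :=
  [seq count (leq j) la | j <- iota 1 (head 0 la)].

Definition remove_first_column la : seq nat :=
  [seq p <- [seq p.-1 | p <- la] | 0 < p].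

Definition J_part (m : nat) (mu : seq nat) : {set 'I_m * 'I_m} :=
  [set r in simple_roots m |
     val r.2 \notin [seq sumn (take p mu) | p <- iota 1 (size mu).-1]].

Definition JJ_part (m : nat) la : {set 'I_m * 'I_m} :=
  simple_roots m :\: J_part m (dual_partition la).

End Partitions.

Section Orientations.

Variables (n : nat) (h : 'I_n -> 'I_n).

Definition Gamma : rel 'I_n := fun a b => (a < b <= h a) || (b < a <= h b).

Definition SK (k : nat) : {set {set 'I_n}} :=
  [set T : {set 'I_n} |
     (#|T| == k) && [forall a in T, forall b in T, ~~ Gamma a b]].

(* An orientation is the set of its arcs (source, target). *)
Definition orientation (om : {set 'I_n * 'I_n}) : bool :=
  [forall a, forall b,
     (((a, b) \in om) || ((b, a) \in om) == Gamma a b)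
     && ~~ (((a, b) \in om) && ((b, a) \in om))].

Definition acyclic (om : {set 'I_n * 'I_n}) : bool :=
  [forall a, forall b,
     ((a, b) \in om) ==> ~~ connect (fun c d => (c, d) \in om) b a].

Definition sk (om : {set 'I_n * 'I_n}) : {set 'I_n} :=
  [set v | [forall u, (v, u) \notin om]].

Definition asc (om : {set 'I_n * 'I_n}) : nat :=
  #|[set e in om | e.1 < e.2]|.

(* The neutral element bounds every asc, so this is the minimum as soon as    *)
(* there is an acyclic orientation with sink set T, see deg_min.              *)
Definition deg (T : {set 'I_n}) : nat :=
  \big[minn/#|{: 'I_n * 'I_n}|]_(om : {set 'I_n * 'I_n} |
     [&& orientation om, acyclic om & sk om == T]) asc om.

Lemma deg_min (T : {set 'I_n}) (om0 : {set 'I_n * 'I_n}) :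
    [&& orientation om0, acyclic om0 & sk om0 == T] ->
  (exists2 om, [&& orientation om, acyclic om & sk om == T] & deg T = asc om)
  /\ (forall om, [&& orientation om, acyclic om & sk om == T] ->
        deg T <= asc om).
Proof.
pose P om := [&& orientation om, acyclic om & sk om == T].
rewrite -/(P om0) => Pom0.
have deg_le om : P om -> deg T <= asc om.
  move=> Pom; rewrite /deg; move: (mem_index_enum om).
  elim: (index_enum _) => //= e s IHs; rewrite inE big_cons.
  case/predU1P=> [<-|/IHs le_s]; first by rewrite -/(P om) Pom geq_minl.
  by case: ifP => // _; rewrite geq_min le_s orbT.
split=> //; have [om Pom min_om] := arg_minnP asc Pom0.
exists om => //; apply/eqP; rewrite eqn_leq deg_le //=.
rewrite /deg; elim/big_ind: _ => [|x y|]; first exact: max_card.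
  by rewrite leq_min => -> ->.
exact: min_om.
Qed.

End Orientations.

Section Deletion.

Variables (n : nat) (T : {set 'I_n}).

(* For t in T, rk t = j (1-based) exactly when t is the j-th smallest element *)
(* l_j of T.                                                                  *)
Definition rk (p : 'I_n) : nat := #|[set t in T | t <= p]|.

Lemma rk_le p : rk p <= #|T|.
Proof. by apply/subset_leq_card/subsetP=> t; rewrite inE => /andP[]. Qed.

Lemma rk_lt (p q : 'I_n) : q \in T -> p < q -> rk p < rk q.
Proof.
move=> Tq lt_pq; apply/proper_card/properP; split.
  apply/subsetP=> t; rewrite !inE => /andP[-> le_tp].
  exact: leq_trans le_tp (ltnW lt_pq).
by exists q; rewrite !inE Tq ?leqnn //= -ltnNge.
Qed.

Lemma rk_gt0 p : p \in T -> 0 < rk p.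
Proof. by move=> Tp; apply/card_gt0P; exists p; rewrite inE Tp leqnn. Qed.

Lemma card_le_n : #|T| <= n.
Proof. by rewrite -[X in _ <= X]card_ord max_card. Qed.

Lemma card_del : #|~: T| = n - #|T|.
Proof. by rewrite cardsCs setCK card_ord. Qed.

Lemma sub_rk (p : 'I_n) : p \notin T -> p - rk p = #|[set t in ~: T | t < p]|.
Proof.
move=> nTp.
have cp : #|[set t : 'I_n | t < p]| = p.
  have wid_inj : injective (widen_ord (ltnW (ltn_ord p))).
    by move=> s t /(congr1 val) /= /val_inj.
  rewrite -[RHS]card_ord -(card_imset _ wid_inj).
  apply: eq_card => t; rewrite inE; apply/idP/imsetP=> [lt_tp|[s _ ->]].
    by exists (Ordinal lt_tp) => //; apply: val_inj.
  exact: (ltn_ord s).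
have := cardsID T [set t : 'I_n | t < p]; rewrite cp.
have -> : #|[set t : 'I_n | t < p] :&: T| = rk p.
  apply: eq_card => t; rewrite !inE andbC; have [Tt|] := boolP (t \in T);
    rewrite ?andbF ?andbT //= [RHS]leq_eqVlt; case: eqP => // /val_inj tp.
  by rewrite tp (negbTE nTp) in Tt.
move=> eq_p; rewrite -[X in X - _]eq_p addKn.
by apply: eq_card => t; rewrite !inE.
Qed.

Lemma f_subproof (j : {j : 'I_n | j \notin T}) :
  val j - rk (val j) < n - #|T|.
Proof.
case: j => j nTj /=; rewrite sub_rk //.
rewrite -card_del.
apply/proper_card/properP; split; first by apply/subsetP=> t /setIdP[].
by exists j; rewrite !inE ?nTj //= ltnn.
Qed.

Definition f_del (j : {j : 'I_n | j \notin T}) : 'I_(n - #|T|) :=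
  Ordinal (f_subproof j).

Lemma f_del_mono (i j : {j : 'I_n | j \notin T}) :
  val i < val j -> f_del i < f_del j.
Proof.
case: i j => [i nTi] [j nTj] /= lt_ij; rewrite !sub_rk //.
apply/proper_card/properP; split.
  by apply/subsetP=> t; rewrite !inE => /andP[-> /ltn_trans->].
by exists i; rewrite !inE nTi ?ltnn.
Qed.

Lemma f_del_inj : injective f_del.
Proof.
move=> i j eq_ij; case: (ltngtP (val i : 'I_n) (val j : 'I_n)).
- by move/f_del_mono; rewrite eq_ij ltnn.
- by move/f_del_mono; rewrite eq_ij ltnn.
by move/val_inj/val_inj.
Qed.

Lemma f_del_codom (a : 'I_(n - #|T|)) : a \in codom f_del.
Proof.
apply: (inj_card_onto f_del_inj); rewrite card_ord card_sig.
rewrite -card_del.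
by apply/subset_leq_card/subsetP=> j; rewrite !inE.
Qed.

Definition f_inv (a : 'I_(n - #|T|)) : {j : 'I_n | j \notin T} :=
  iinv (f_del_codom a).

Lemma f_invK : cancel f_inv f_del.
Proof. by move=> a; apply: f_iinv. Qed.

Lemma f_delK : cancel f_del f_inv.
Proof. by move=> j; apply: f_del_inj; rewrite f_invK. Qed.

Lemma h_del_subproof (h : 'I_n -> 'I_n) (a : 'I_(n - #|T|)) :
  #|[set j in ~: T | j <= h (val (f_inv a))]|.-1 < n - #|T|.
Proof.
have le_A : #|[set j in ~: T | j <= h (val (f_inv a))]| <= n - #|T|.
  by rewrite -card_del; apply/subset_leq_card/subsetP=> t /setIdP[].
have n_gt0 : 0 < n - #|T| by apply: leq_trans (ltn_ord a).
by case: #|_| le_A.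
Qed.

(* The predecessor is the shift to 0-based values. *)
Definition h_del (h : 'I_n -> 'I_n) (a : 'I_(n - #|T|)) : 'I_(n - #|T|) :=
  Ordinal (h_del_subproof h a).

(* l_j carries k - j + 1, that is the ordinal k - j, where k = #|T|. *)
Definition W_set_T (i : int) (J : {set 'I_n * 'I_n}) (h : 'I_n -> 'I_n) :
    {set 'S_n} :=
  [set w in W_set i J h | [forall t in T, w t == #|T| - rk t :> nat]].

Lemma w_T_subproof (p : 'I_n) :
  (if p \in T then #|T| - rk p else #|T| + (p - rk p)) < n.
Proof.
case: ifPn => [Tp|nTp].
  have T_gt0 : 0 < #|T| by apply/card_gt0P; exists p.
  by apply: leq_trans card_le_n; rewrite ltn_subrL rk_gt0.
have := f_subproof (exist _ p nTp); rewrite /= -(ltn_add2l #|T|) subnKC //.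
exact: card_le_n.
Qed.

(* Off T the values k, k + 1, .. (0-based) are taken in increasing order. *)
Definition w_T_fun (p : 'I_n) : 'I_n := Ordinal (w_T_subproof p).

Lemma w_T_inj : injective w_T_fun.
Proof.
have sep p q : p \in T -> q \notin T -> w_T_fun p <> w_T_fun q.
  move=> Tp nTq /(congr1 val) /=; rewrite Tp (negbTE nTq) => eq_pq.
  have: #|T| <= #|T| - rk p by rewrite eq_pq leq_addr.
  rewrite leqNgt ltn_subrL rk_gt0 //= => /negP; apply.
  by apply/card_gt0P; exists p.
move=> p q; have [Tp|nTp] := boolP (p \in T);
  have [Tq|nTq] := boolP (q \in T) => eq_pq.
- have eq_rk : rk p = rk q.
    move/(congr1 val): eq_pq => /=; rewrite Tp Tq => eq_pq.
    by rewrite -(subKn (rk_le p)) eq_pq subKn ?rk_le.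
  case: (ltngtP p q) => [/(rk_lt Tq)|/(rk_lt Tp)|/val_inj//];
    by rewrite eq_rk ltnn.
- by case: (sep p q).
- by case: (sep q p).
move/(congr1 val): eq_pq => /=; rewrite (negbTE nTp) (negbTE nTq) => /addnI eq.
have: f_del (exist _ p nTp) = f_del (exist _ q nTq) by apply: val_inj.
by move/f_del_inj/(congr1 val).
Qed.

Definition w_T : 'S_n := perm w_T_inj.

(* The permutation x of 'I_(n - #|T|) with x (f_del j) = f_del (sigma j) for  *)
(* j outside T, which exists when sigma fixes T pointwise, see x_sigmaP; the  *)
(* default value 1 is irrelevant.                                             *)
Definition x_sigma (sigma : 'S_n) : 'S_(n - #|T|) :=
  odflt 1%g [pick x : 'S_(n - #|T|) |
     [forall j : {j | j \notin T}, forall j' : {j | j \notin T},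
        (sigma (val j) == val j') ==> (x (f_del j) == f_del j')]].

Lemma x_sigmaP (sigma : 'S_n) : (forall t, t \in T -> sigma t = t) ->
  forall j j' : {j | j \notin T},
    sigma (val j) = val j' -> x_sigma sigma (f_del j) = f_del j'.
Proof.
move=> fixT; rewrite /x_sigma; case: pickP => [x /= xP|nox] j j' eqj.
  by move: xP => /forallP/(_ j)/forallP/(_ j')/implyP/(_ (introT eqP eqj))/eqP.
have stab (i : {j : 'I_n | j \notin T}) : sigma (val i) \notin T.
  apply/negP=> Ti; have /perm_inj eqi := fixT _ Ti.
  by rewrite eqi (negbTE (valP i)) in Ti.
pose y a := f_del (exist (fun j => j \notin T) _ (stab (f_inv a))).
have y_inj : injective y.
  by move=> a b /f_del_inj/(congr1 val)/perm_inj/val_inj/(can_inj f_invK).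
have /negP[] := negbT (nox (perm y_inj)).
apply/forallP=> i; apply/forallP=> i'; apply/implyP=> /eqP eqi.
rewrite permE /y; apply/eqP; congr f_del; apply: val_inj.
by rewrite /= f_delK.
Qed.

(* The factorization w = w_T sigma composes functions from right to left,     *)
(* whereas permutations multiply from left to right.                          *)
Definition Psi (w : 'S_n) : 'S_(n - #|T|) := x_sigma (w * w_T^-1)%g.

Lemma Psi_stab (w : 'S_n) :
    (forall t, t \in T -> w t = #|T| - rk t :> nat) ->
  forall t, t \in T -> (w * w_T^-1)%g t = t.
Proof.
move=> wP t Tt; rewrite permM; apply: (canLR (permK _)).
by apply: val_inj; rewrite permE /= Tt; apply: wP.
Qed.

End Deletion.

Arguments h_del {n} T h a.

(* Main.v *)
(* For w with w(l_j) = k - j + 1, the permutation x = Psi_T w satisfies        *)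
(* w(p) = k + x(f_T(p)) for p outside T, so Psi_T is a bijection onto all of   *)
(* S_(n-k), and the conditions on w and x are compared simple root by simple   *)
(* root.  Simple roots inside the first block of lambda^\vee hold since T is   *)
(* independent; the root alpha_k, on the border of that block, holds because T *)
(* is a maximum independent set: adding the sums of consecutive roots of an    *)
(* independent set shows that no such set has more than ht(I_h) + 1 elements.  *)
(* All values on T are below those off T, so the inversions of w in Phi_h^-    *)
(* meeting T are exactly the edges whose larger vertex is in T.  These are     *)
(* ascents of every acyclic orientation with sink set T, and there are no      *)
(* others when the edges not meeting T point to their smaller vertex; that     *)
(* orientation has sink set T, again because T is maximum.  Their number is    *)
(* thus deg_h(T).                                                              *)

Require Import Defs.
From mathcomp Require Import all_boot all_order all_algebra all_fingroup.
From mathcomp Require Import zify.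

Set Implicit Arguments.
Unset Strict Implicit.
Unset Printing Implicit Defensive.

(** Let k be the size of T. A permutation w with the prescribed values on T takes off T the values
    of [Psi T w] raised by k ([PsiE]), so [Psi T] is a bijection from all such w onto the symmetric
    group ([Psi_inj], [Psi_surj]), and it remains to match the membership conditions of w and of its
    image. [W_setP] turns the root conditions into one test per pair of consecutive values;
    [Psi_simple_roots] transfers these tests, T absorbing the first block of the dual partition. By
    [card_inv_h_Psi] the inversion counts differ by a number independent of w, which [deg_edges_up]
    identifies as the degree of T. The border root and the degree both need T to be dominating, a
    consequence of [independent_leq_height]. *)

(** * Independent sets and the height of the ideal *)

Definition independent (n : nat) (h : 'I_n -> 'I_n) (S : {set 'I_n}) : Prop :=
  {in S &, forall a b, ~~ Gamma h a b}.

Lemma independent_lt (n : nat) (h : 'I_n -> 'I_n) (S : {set 'I_n}) :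
  independent h S -> {in S &, forall a b : 'I_n, a < b -> h a < b}.
Proof.
move=> indS a b Sa Sb lt_ab; have := indS a b Sa Sb.
by rewrite /Gamma lt_ab /= negb_or -ltnNge => /andP[].
Qed.

(** List S increasingly as s_0 < s_1 < ... . Independence puts each (s_(i+1), s_i) in [I_h h], and
    these roots telescope: (s_(j+1), s_0) lies in the term of index j, so at least |S| - 1 terms are
    nonempty. *)
Lemma independent_leq_height (n : nat) (h : 'I_n -> 'I_n) (S : {set 'I_n}) :
  independent h S -> #|S| <= height (I_h h) + 1.
Proof.
move=> indS; have [->|[x0 Sx0]] := set_0Vmem S; first by rewrite cards0.
pose s := nth x0 (enum S).
have sizeS : size (enum S) = #|S| by rewrite cardE.
have sS j : j < #|S| -> s j \in S.
  by move=> ltj; rewrite -mem_enum mem_nth ?sizeS.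
have sorted_enumS : sorted ltn (map val (enum S)).
  rewrite sorted_map {1}/enum_mem; apply: sorted_filter => [y x z|].
    exact: ltn_trans.
  by rewrite -enumT -sorted_map val_enum_ord iota_ltn_sorted.
have s_lt i j : i < j -> j < #|S| -> s i < s j.
  move=> lt_ij ltj; have lti := ltn_trans lt_ij ltj.
  have := sorted_ltn_nth ltn_trans (x0 : nat) sorted_enumS.
  move=> /(_ i j); rewrite !inE size_map sizeS => /(_ lti ltj lt_ij).
  by rewrite !(nth_map x0) ?sizeS.
have s_I i : i.+1 < #|S| -> (s i.+1, s i) \in I_h h.
  move=> lti; rewrite !inE /= s_lt //= andbT.
  rewrite -ltnNge; apply: (independent_lt indS); rewrite ?sS ?s_lt //.
  exact: ltnW.
have s_lc j : j.+1 < #|S| -> (s j.+1, s 0) \in lower_central (I_h h) j.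
  elim: j => [|j IHj] ltj; first exact: s_I.
  rewrite inE /= inE /= s_lt //=; apply/exists_inP.
  exists (s j.+1, s 0); first by apply: IHj; apply: ltnW.
  apply/exists_inP; exists (s j.+2, s j.+1); first exact: s_I.
  by apply/eqP; rewrite /root_vec /= [RHS]GRing.addrC GRing.addrA GRing.subrK.
have leSn : #|S|.-1 <= n by apply: leq_trans (leq_pred _) (card_le_n S).
rewrite addn1 -ltnS -[X in X < _]prednK ?ltnS; last by apply/card_gt0P; exists x0.
rewrite -[X in X <= _]card_ord -cardsT.
have wid_inj : injective (widen_ord leSn).
  by move=> a b /(congr1 val) /= /val_inj.
rewrite -(card_imset _ wid_inj); apply/subset_leq_card/subsetP => _ /imsetP[j _ ->].
rewrite inE; apply/set0Pn; exists (s j.+1, s 0); apply: s_lc => /=.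
by rewrite -ltn_predRL.
Qed.

(** * Maximum independent sets and the least number of ascents *)

Section MaximumIndependent.

Variables (n : nat) (h : 'I_n -> 'I_n) (T : {set 'I_n}).
Hypotheses (indT : independent h T) (maxT : #|T| = height (I_h h) + 1).

Lemma Gamma_sym : symmetric (Gamma h).
Proof. by move=> a b; rewrite /Gamma orbC. Qed.

Lemma Gamma_irr a : ~~ Gamma h a a.
Proof. by rewrite /Gamma ltnn. Qed.

Lemma maximum_dominates v : v \notin T -> exists2 t, t \in T & Gamma h v t.
Proof.
move=> nTv; apply/exists_inP; apply: contraT; rewrite negb_exists_in.
move=> /forall_inP nadj.
have: independent h (v |: T).
  move=> a b; rewrite !inE => /predU1P[->|Ta] /predU1P[->|Tb].
  - exact: Gamma_irr.
  - exact: nadj.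
  - by rewrite Gamma_sym nadj.
  - exact: indT.
by move/independent_leq_height; rewrite cardsU1 nTv maxT add1n ltnn.
Qed.

Definition edges_up_to_T : {set 'I_n * 'I_n} :=
  [set r in Phi_h_neg h | r.1 \in T].

(** An edge whose larger end is a sink is an ascent, which gives the lower bound. It is attained by
    [om0], where edges meeting T point into T and all others point to their smaller end. *)
Lemma deg_edges_up : deg h T = #|edges_up_to_T|.
Proof.
pose swap (r : 'I_n * 'I_n) := (r.2, r.1).
have swapK : involutive swap by case.
have cardE : #|edges_up_to_T| = #|swap @: edges_up_to_T|.
  by rewrite card_imset //; apply: inv_inj.
have in_swap a b : ((a, b) \in swap @: edges_up_to_T) = (a < b <= h a) && (b \in T).
  by rewrite -[(a, b)]/(swap (b, a)) mem_imset ?inE //; apply: inv_inj.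
pose om0 := [set e : 'I_n * 'I_n |
  [&& Gamma h e.1 e.2, e.1 \notin T & (e.2 \in T) || (e.2 < e.1)]].
have om0P : [&& orientation h om0, acyclic om0 & sk om0 == T].
  apply/and3P; split.
  - apply/forallP=> a; apply/forallP=> b; rewrite !inE /= (Gamma_sym b a).
    have [Gab|//] := boolP (Gamma h a b).
    have neq_ab : (a : nat) != b by move: Gab; rewrite /Gamma; case: ltngtP.
    have nTab : ~~ ((a \in T) && (b \in T)).
      by apply: contraL Gab => /andP[Ta Tb]; apply: indT.
    by move: nTab neq_ab; case: (a \in T); case: (b \in T); case: ltngtP.
  (* A level that drops along every arc excludes cycles; T sits at the bottom because arcs into T
     may ascend. *)
  - pose phi (v : 'I_n) := if v \in T then 0 else v.+1.
    have phi_lt a b : (a, b) \in om0 -> phi b < phi a.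
      rewrite inE /= /phi => /and3P[_ /negbTE-> /orP[->//|lt_ba]].
      by case: ifP => // _; rewrite ltnS.
    have phi_le a b : connect (fun c d => (c, d) \in om0) a b -> phi b <= phi a.
      case/connectP=> p; elim: p a => [|c p IHp] a /= => [_ ->//|/andP[/phi_lt lt_ca]].
      by move=> /IHp IH /IH le_bc; apply: leq_trans le_bc (ltnW lt_ca).
    apply/forallP=> a; apply/forallP=> b; apply/implyP=> /phi_lt.
    by rewrite ltnNge; apply/contra/phi_le.
  apply/eqP/setP=> v; rewrite inE; apply/forallP/idP => [sinkv|Tv u].
    apply: contraT => nTv; have [t Tt Gvt] := maximum_dominates nTv.
    by have := sinkv t; rewrite inE /= Gvt nTv Tt.
  by rewrite inE /= Tv andbF.
have [[om omP degE] deg_le] := deg_min om0P.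
apply/eqP; rewrite eqn_leq; apply/andP; split; last first.
  rewrite degE cardE; apply/subset_leq_card/subsetP => -[a b].
  rewrite in_swap inE /=.
  case/and3P: omP => /forallP/(_ a)/forallP/(_ b) /andP[/eqP or_ab _] _ /eqP skT.
  case/andP=> adj; rewrite -skT inE => /forallP/(_ a)/negbTE nba.
  case/andP: (adj) => -> _; rewrite andbT.
  by move: or_ab; rewrite nba orbF /Gamma adj => ->.
apply: leq_trans (deg_le _ om0P) _.
rewrite cardE; apply/subset_leq_card/subsetP => -[a b].
rewrite in_swap !inE /= /Gamma => /andP[/and3P[Gab _ ba] lt_ab].
by move: ba Gab; rewrite lt_ab [b < a]ltnNge ltnW //= !orbF => -> ->.
Qed.

End MaximumIndependent.

(** * The bijection onto the whole symmetric group *)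

Section ValuesOffT.

Variables (n : nat) (T : {set 'I_n}).

Definition T_values (w : 'S_n) : Prop :=
  forall t, t \in T -> w t = #|T| - rk T t :> nat.

Lemma w_TE p :
  w_T T p = (if p \in T then #|T| - rk T p else #|T| + (p - rk T p)) :> nat.
Proof. by rewrite permE. Qed.

Lemma T_values_lt (w : 'S_n) t : T_values w -> t \in T -> w t < #|T|.
Proof. by move=> wT Tt; have := rk_gt0 Tt; have := rk_le T t; rewrite wT; lia. Qed.

(** The factor sigma fixes T pointwise, hence preserves its complement, on which [w_T] is the
    increasing relabelling shifted by k. *)
Lemma PsiE (w : 'S_n) (j : {j : 'I_n | j \notin T}) : T_values w ->
  w (val j) = #|T| + Psi T w (f_del j) :> nat.
Proof.
move=> wT; have fixT := Psi_stab wT; pose s := (w * (w_T T)^-1)%g.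
have nTs : s (val j) \notin T.
  apply/negP=> Ts; have /perm_inj eqj := fixT _ Ts.
  by have := valP j; rewrite -eqj Ts.
rewrite /Psi (x_sigmaP fixT (j' := exist (fun j => j \notin T) _ nTs)) //.
have -> : w (val j) = w_T T (s (val j)) by rewrite permM permKV.
by rewrite w_TE (negbTE nTs).
Qed.

Lemma T_values_ge (w : 'S_n) p : T_values w -> p \notin T -> #|T| <= w p.
Proof. by move=> wT nTp; rewrite (PsiE (exist _ p nTp) wT) leq_addr. Qed.

Lemma Psi_inj (w w' : 'S_n) :
  T_values w -> T_values w' -> Psi T w = Psi T w' -> w = w'.
Proof.
move=> wT w'T eqP; apply/permP=> p; apply: val_inj => /=.
have [Tp|nTp] := boolP (p \in T); first by rewrite wT ?w'T.
by rewrite (PsiE (exist _ p nTp) wT) (PsiE (exist _ p nTp) w'T) eqP.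
Qed.

Lemma Psi_surj (x : 'S_(n - #|T|)) : exists2 w, T_values w & Psi T w = x.
Proof.
(* The candidate sigma: x transported along the relabelling, extended by the identity on T. *)
pose s (p : 'I_n) : 'I_n :=
  if insub p is Some j then val (f_inv (x (f_del (j : {j | j \notin T})))) else p.
have sT p : p \in T -> s p = p.
  by move=> Tp; rewrite /s insubF // Tp.
have sN (j : {j | j \notin T}) : s (val j) = val (f_inv (x (f_del j))).
  by rewrite /s valK.
have s_inj : injective s.
  move=> p q; have [Tp|nTp] := boolP (p \in T); have [Tq|nTq] := boolP (q \in T).
  - by rewrite !sT.
  - rewrite sT // (sN (exist _ q nTq)) => eqp.
    by have := valP (f_inv (x (f_del (exist _ q nTq)))); rewrite -eqp Tp.
  - rewrite (sT q) // (sN (exist _ p nTp)) => eqp.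
    by have := valP (f_inv (x (f_del (exist _ p nTp)))); rewrite eqp Tq.
  rewrite (sN (exist _ p nTp)) (sN (exist _ q nTq)).
  by move=> /val_inj/(can_inj (@f_invK _ _))/perm_inj/f_del_inj/(congr1 val).
pose w := (perm s_inj * w_T T)%g.
have wE p : w p = w_T T (s p) by rewrite permM [perm s_inj _]permE.
have wT : T_values w by move=> t Tt; rewrite wE sT // w_TE Tt.
exists w => //; apply/permP=> a; rewrite -[a]f_invK; apply: val_inj => /=.
apply/eqP; rewrite -(eqn_add2l #|T|) -(PsiE _ wT) wE sN f_invK.
by rewrite w_TE (negbTE (valP (f_inv (x a)))) -[in X in _ == X](f_invK (x a)).
Qed.

Lemma f_del_ltE (p q : {j : 'I_n | j \notin T}) :
  (f_del p < f_del q) = (val p < val q).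
Proof.
apply/idP/idP; last exact: f_del_mono.
apply: contraTT; rewrite -!leqNgt leq_eqVlt => /predU1P[/val_inj/val_inj->//|].
by move/f_del_mono/ltnW.
Qed.

(** Both sides compare the number of vertices off T below p with the number of those up to [h q].
    The hypothesis makes the latter positive, so the predecessor in [h_del] does not truncate. *)
Lemma f_del_le_h_del (h : 'I_n -> 'I_n) (p q : {j : 'I_n | j \notin T}) :
  val q <= h (val q) -> (f_del p <= h_del T h (f_del q)) = (val p <= h (val q)).
Proof.
move=> le_qh; rewrite /= f_delK sub_rk ?(valP p) //.
set A := [set j in ~: T | j <= h (val q)].
have A_gt0 : 0 < #|A|.
  by apply/card_gt0P; exists (val q); rewrite !inE (valP q).
rewrite -ltnS prednK //; have [le_ph|lt_hp] := leqP (val p) (h (val q)).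
  apply/proper_card/properP; split.
    by apply/subsetP=> t; rewrite !inE => /andP[-> /ltnW/leq_trans->].
  by exists (val p); rewrite !inE ?ltnn ?andbF // (valP p).
apply/negbTE; rewrite -leqNgt; apply/subset_leq_card/subsetP=> t.
by rewrite !inE => /andP[-> le_th]; apply: leq_ltn_trans lt_hp.
Qed.

End ValuesOffT.

(** * Simple roots and cuts of the dual partition *)

(** These index the simple roots missing from [J_part], hence those forming [JJ_part] when [mu] is
    the dual partition. *)
Definition cuts (mu : seq nat) : seq nat :=
  [seq sumn (take p mu) | p <- iota 1 (size mu).-1].

(* For p <> q, the root (p, q) is in I_h exactly when p > h q, and in Phi_h    *)
(* otherwise.                                                                  *)
Lemma W_setP (m : nat) (h : 'I_m -> 'I_m) (i : int) (la : seq nat) (w : 'S_m) :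
    (forall j : 'I_m, j <= h j) ->
  w \in W_set i (JJ_part m la) h <->
  (forall p q : 'I_m, w q = (w p).+1 :> nat ->
     ((w q : nat) \in cuts (dual_partition la)) = (p <= h q)) /\
  #|inv_h h w|%:Z%R = i.
Proof.
move=> le_h; rewrite /W_set inE.
have rootsP (p q : 'I_m) : p != q :> nat ->
    ((p, q) \in Phi_h h) = (p <= h q) /\ ((p, q) \in I_h h) = ~~ (p <= h q).
  by move=> neq; have := le_h q; rewrite !inE /=; lia.
have JJE r : (r \in JJ_part m la) =
    (r \in simple_roots m) && (val r.2 \in cuts (dual_partition la)).
  by rewrite !inE -/(cuts _); case: eqP => //= _; rewrite negbK andbT.
split=> [/and3P[/subsetP sub1 /subsetP sub2 /eqP->]|[wP ->]].
  split=> // p q eqw.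
  have neq : p != q :> nat by apply/eqP=> /val_inj eqpq; move: eqw; rewrite eqpq; lia.
  have [PhiE IE] := rootsP p q neq.
  have simp : (w p, w q) \in simple_roots m by rewrite inE /= eqw.
  have pqE : (p, q) = (w^-1 (w p), w^-1 (w q))%g by rewrite !permK.
  have [cut|ncut] := boolP (_ \in cuts _).
    rewrite -PhiE pqE; apply/esym/sub1/imsetP; exists (w p, w q) => //.
    by rewrite JJE simp.
  apply/esym/negbTE; rewrite -IE pqE; apply/sub2/imsetP; exists (w p, w q) => //.
  by rewrite in_setD JJE simp /= ncut.
rewrite eqxx andbT; apply/andP; split; apply/subsetP=> _ /imsetP[[u v] + ->] /=.
  rewrite JJE => /andP[]; rewrite inE /= => /eqP eqv cut.
  have := wP (w^-1 u)%g (w^-1 v)%g; rewrite !permKV => /(_ eqv).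
  rewrite cut => le; have [|-> _] := rootsP (w^-1 u)%g (w^-1 v)%g; last by [].
  by apply/eqP=> /val_inj/perm_inj equv; move: eqv; rewrite equv; lia.
rewrite in_setD JJE => /andP[ncut simp]; move: ncut; rewrite simp /= => ncut.
move: simp; rewrite inE /= => /eqP eqv.
have := wP (w^-1 u)%g (w^-1 v)%g; rewrite !permKV => /(_ eqv).
rewrite (negbTE ncut) => le; have [|_ ->] := rootsP (w^-1 u)%g (w^-1 v)%g; last by rewrite -le.
by apply/eqP=> /val_inj/perm_inj equv; move: eqv; rewrite equv; lia.
Qed.

(** Removing the first column of a diagram removes the first row of its transpose. The bound on n
    excludes the empty partition, whose dual has no first part. *)
Lemma dual_partition_remove (n : nat) (la : seq nat) :
    is_partition n la -> 0 < n ->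
  dual_partition la = size la :: dual_partition (remove_first_column la).
Proof.
case: la => [|a la /and3P[srt /= /andP[a_gt0 la_gt0] _] _].
  by case/and3P=> _ _ /eqP<-.
have la_le : all (geq a) la.
  by apply: order_path_min srt => y x z /=; lia.
have iotaE : iota 1 a = 1 :: iota (1 + 1) a.-1 by rewrite -{1}(prednK a_gt0).
have cnt1 : count (leq 1) (a :: la) = size (a :: la).
  by apply/eqP; rewrite -all_count /= a_gt0.
rewrite /dual_partition [head 0 _]/= iotaE map_cons cnt1; congr (_ :: _).
have -> : head 0 (remove_first_column (a :: la)) = a.-1.
  rewrite /remove_first_column /=; case: ifP => //= a1.
  have -> : [seq p <- [seq p.-1 | p <- la] | 0 < p] = [::].
    apply/eqP; rewrite -size_eq0 size_filter -leqn0 leqNgt -has_count has_map.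
    apply/hasPn=> p pla /=; have := allP la_le p pla => /=; lia.
  by rewrite /=; lia.
rewrite iotaDl -map_comp; apply/eq_in_map => j.
rewrite mem_iota => /andP[j_gt0 _] /=.
rewrite -[LHS]/(count (leq (1 + j)) (a :: la)) /remove_first_column.
rewrite count_filter count_map; apply: eq_count => p /=; lia.
Qed.

Lemma cuts_cons (a : nat) (mu : seq nat) (v : nat) : 0 < v ->
  (a + v \in cuts (a :: mu)) = (v \in cuts mu).
Proof.
move=> v_gt0; rewrite /cuts /=; case: mu => //= b mu; rewrite inE addn0.
rewrite -[2]/(1 + 1) iotaDl -!map_comp.
have -> : (a + v == a) = false by lia.
apply/mapP/mapP=> -[p pP /= eqp]; exists p => //=; last by rewrite eqp.
by apply/eqP; rewrite -(eqn_add2l a) eqp.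
Qed.

Lemma cuts_cons_ge (a : nat) (mu : seq nat) (v : nat) :
  v \in cuts (a :: mu) -> a <= v.
Proof.
case/mapP=> -[|p]; first by rewrite mem_iota.
by move=> _ -> /=; rewrite leq_addr.
Qed.

Lemma cuts_cons_head (a : nat) (mu : seq nat) :
  (a \in cuts (a :: mu)) = (mu != [::]).
Proof. by case: mu => //= b mu; rewrite /cuts /= inE addn0 eqxx. Qed.

Lemma dual_partition_neq0 (n : nat) (la : seq nat) :
    is_partition n la -> size la < n ->
  dual_partition (remove_first_column la) != [::].
Proof.
move=> /and3P[_ la_gt0 /eqP sumla] lt_n.
have: has (leq 2) la.
  apply: contraLR lt_n; rewrite -all_predC -leqNgt -sumla => /allP le1.
  elim: la la_gt0 le1 {sumla} => //= a la IH /andP[_ la_gt0] le1.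
  have := le1 a (mem_head _ _); have /(IH la_gt0) : {in la, forall p, predC (leq 2) p}.
    by move=> p pla; apply: le1; rewrite inE pla orbT.
  by rewrite /=; lia.
have: all (leq 1) (remove_first_column la) by apply: filter_all.
have -> : has (leq 2) la = (remove_first_column la != [::]).
  rewrite -size_eq0 size_filter -lt0n -has_count has_map.
  by apply: eq_has => p /=; lia.
by case: (remove_first_column la) => //= -[|b] //.
Qed.

(** * Comparison of the conditions on w and on its image *)

(** Values on T lie below those off T. Hence an inversion whose larger position is off T avoids T
    altogether and is seen by the image, while every edge whose larger vertex is in T is an
    inversion. *)
Lemma card_inv_h_Psi (n : nat) (h : 'I_n -> 'I_n) (T : {set 'I_n}) (w : 'S_n) :
    (forall j : 'I_n, j <= h j) -> independent h T -> T_values T w ->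
  #|inv_h h w| = #|inv_h (h_del T h) (Psi T w)| + #|edges_up_to_T h T|.
Proof.
move=> le_h indT wT; rewrite -(cardsID [set r | r.1 \in T]) addnC; congr (_ + _).
  pose g (r : 'I_(n - #|T|) * 'I_(n - #|T|)) := (val (f_inv r.1), val (f_inv r.2)).
  have g_inj : injective g.
    by move=> [a b] [c d] [/val_inj/(can_inj (@f_invK _ _))-> /val_inj/(can_inj (@f_invK _ _))->].
  rewrite -(card_imset _ g_inj); apply: eq_card => -[p q].
  have in_inv (u v : {j : 'I_n | j \notin T}) :
      ((val u, val v) \in inv_h h w) =
      ((f_del u, f_del v) \in inv_h (h_del T h) (Psi T w)).
    rewrite !in_setI ![_ \in Phi_h_neg _]inE ![_ \in inv_set _]inE /=.
    rewrite -[_.-1]/(h_del T h (f_del v) : nat) -[val u - _]/(f_del u : nat).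
    rewrite -[val v - _]/(f_del v : nat) f_del_le_h_del // f_del_ltE.
    by rewrite !(PsiE _ wT) ltn_add2l.
  apply/setDP/imsetP=> [[inv]|[[a b] inv [-> ->]]]; last first.
    by split; [rewrite in_inv !f_invK | rewrite inE (valP (f_inv a))].
  rewrite inE /= => nTp; have nTq : q \notin T.
    apply/negP=> Tq; move: inv; rewrite !inE /=.
    by have := T_values_ge wT nTp; have := T_values_lt wT Tq; lia.
  exists (f_del (exist _ p nTp), f_del (exist _ q nTq)); last by rewrite /g !f_delK.
  by rewrite -in_inv.
apply: eq_card => -[p q]; rewrite !inE /=; have [Tp|] := boolP (p \in T); rewrite ?andbF // !andbT.
apply/idP/idP=> [/andP[]//|adj]; rewrite adj andbT; case/andP: (adj) => -> le_ph /=.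
have nTq : q \notin T.
  apply/negP=> Tq; have := indT p q Tp Tq.
  by rewrite /Gamma adj orbT.
exact: leq_trans (T_values_lt wT Tp) (T_values_ge wT nTq).
Qed.

Lemma Psi_simple_roots (n : nat) (h : 'I_n -> 'I_n) (T : {set 'I_n})
    (mu : seq nat) (w : 'S_n) :
    (forall j : 'I_n, j <= h j) -> independent h T ->
    #|T| = height (I_h h) + 1 -> (#|T| < n -> mu != [::]) -> T_values T w ->
  (forall p q : 'I_n, w q = (w p).+1 :> nat ->
     ((w q : nat) \in cuts (#|T| :: mu)) = (p <= h q)) <->
  (forall a b : 'I_(n - #|T|), Psi T w b = (Psi T w a).+1 :> nat ->
     ((Psi T w b : nat) \in cuts mu) = (a <= h_del T h b)).
Proof.
move=> le_h indT maxT mu_neq0 wT; split=> [wP a b eqx|xP p q eqw].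
  have := wP (val (f_inv a)) (val (f_inv b)); rewrite !(PsiE _ wT) !f_invK.
  rewrite eqx addnS => /(_ erefl); rewrite -addnS cuts_cons // => ->.
  by rewrite -f_del_le_h_del // !f_invK.
have [Tp|nTp] := boolP (p \in T); have [Tq|nTq] := boolP (q \in T).
(* Inside the first block: values decrease along T, so q < p and independence gives [h q < p], while
   the value at q is too small to be a cut. *)
- have lt_q := T_values_lt wT Tq.
  have lt_rk : rk T q < rk T p.
    by move: eqw; rewrite !wT //; have := rk_le T p; have := rk_le T q; lia.
  have lt_qp : q < p.
    rewrite ltnNge; apply/negP; rewrite leq_eqVlt => /predU1P[/val_inj eqpq|].
      by move: lt_rk; rewrite eqpq ltnn.
    by move/(rk_lt Tq); lia.
  rewrite [RHS]leqNgt (independent_lt indT) //=.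
  by apply/negbTE/negP=> /cuts_cons_ge; rewrite leqNgt lt_q.
(* The border root: the values are k - 1 and k, so p is the least element of T, and k is a cut. *)
- have wq : w q = #|T| :> nat.
    by have := T_values_lt wT Tp; have := T_values_ge wT nTq; lia.
  have le_pT t : t \in T -> p <= t.
    move=> Tt; rewrite leqNgt; apply/negP=> /(rk_lt Tp) lt_tp.
    by have := rk_gt0 Tt; move: eqw; rewrite wq (wT _ Tp); have := rk_le T p; lia.
  rewrite wq cuts_cons_head mu_neq0; last by rewrite -wq ltn_ord.
  (* Otherwise q and [h q] would lie below all of T, leaving q without a neighbour in T. *)
  apply/esym; rewrite leqNgt; apply/negP=> lt_hp.
  have [t /le_pT le_pt] := maximum_dominates indT maxT nTq.
  by rewrite /Gamma; have := le_h q; lia.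
- by have := T_values_lt wT Tq; have := T_values_ge wT nTp; lia.
move: eqw; rewrite (PsiE (exist _ p nTp) wT) (PsiE (exist _ q nTq) wT) -addnS.
move=> /addnI eqx; rewrite cuts_cons; last by rewrite eqx.
by rewrite (xP _ _ eqx) f_del_le_h_del.
Qed.

Theorem theorem5p25 (n : nat) (hn : 0 < n)
    (h : 'I_n -> 'I_n) (hh : hessenberg h)
    (k : nat) (hk : k = height (I_h h) + 1)
    (la : seq nat) (hla : is_partition n la) (hlak : size la = k)
    (T : {set 'I_n}) (hT : T \in SK h k)
    (i : int) :
  {in W_set_T T i (JJ_part n la) h &, injective (Psi T)} /\
  Psi T @: W_set_T T i (JJ_part n la) h =
    W_set (i - (deg h T)%:Z)%R
          (JJ_part (n - #|T|) (remove_first_column la)) (h_del T h).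
Proof.
move: hT; rewrite inE => /andP[/eqP cardT /forall_inP indT0].
have indT : independent h T.
  by move=> a b Ta Tb; have /forall_inP := indT0 a Ta; apply.
have maxT : #|T| = height (I_h h) + 1 by rewrite cardT.
have [_ le_h] := hh.
have le_hT (a : 'I_(n - #|T|)) : a <= h_del T h a.
  by have := f_del_le_h_del (f_inv a) (le_h (val (f_inv a))); rewrite !f_invK le_h.
have dualE := dual_partition_remove hla hn.
have mu_neq0 : #|T| < n -> dual_partition (remove_first_column la) != [::].
  by rewrite cardT -hlak; apply: dual_partition_neq0.
have WE (w : 'S_n) : T_values T w ->
    (w \in W_set i (JJ_part n la) h) =
    (Psi T w \in W_set (i - (deg h T)%:Z)%R
          (JJ_part (n - #|T|) (remove_first_column la)) (h_del T h)).
  move=> wT; have [rootsP1 rootsP2] := Psi_simple_roots le_h indT maxT mu_neq0 wT.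
  have cardE := card_inv_h_Psi le_h indT wT.
  apply/idP/idP=> /W_setP.
    case/(_ le_h); rewrite dualE hlak -cardT => /rootsP1 xP eqi.
    apply/W_setP => //; split=> //.
    by rewrite -eqi cardE (deg_edges_up indT maxT); lia.
  case/(_ le_hT) => /rootsP2 wP eqi; apply/W_setP => //.
  rewrite dualE hlak -cardT; split=> //.
  by rewrite cardE -(deg_edges_up indT maxT); lia.
have WTP w : reflect (T_values T w /\ w \in W_set i (JJ_part n la) h)
                     (w \in W_set_T T i (JJ_part n la) h).
  apply: (iffP setIdP) => -[Ww wT]; split=> //.
    by move=> t Tt; apply/eqP; move/forall_inP: wT; apply.
  by apply/forall_inP=> t Tt; apply/eqP/Ww.
split=> [w w' /WTP[wT _] /WTP[w'T _]|]; first exact: Psi_inj.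
apply/setP=> x; apply/imsetP/idP=> [[w /WTP[wT Ww] ->]|Wx].
  by rewrite -WE.
have [w wT eqx] := Psi_surj x; exists w => //.
by apply/WTP; split=> //; rewrite WE ?eqx.
Qed.
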